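(* Let $A=\mathbb{R}$, $\hat A=\{a_1,\dots,a_k\}\subset\mathbb{R}$ finite, and let $\rho:A\times\hat A\to[0,M]$ ($M<\infty$) be a (measurable) bounded distortion function with $\sup_{x\in A}\min_{y\in\hat A}\rho(x,y)=0$. Let $P$ be a Borel probability measure on $\mathbb{R}$ with $D_{\max}=\min_{y\in\hat A}E_P[\rho(X,y)]>0$, and suppose there is a nonempty open interval $I\subset\mathbb{R}$ on which $P$ has an absolutely continuous component (with respect to Lebesgue measure) with density $g$ satisfying $g(x)>0$ for $x\in I$. Write $r_j(x)=\rho(x,a_j)$ for $1\le j\le k$ and $r_0(x)\equiv 0$, and assume that each $r_j$ is continuous on $I$. Let $X_1\sim P$, and for $D\in(0,D_{\max})$ let $f=f_D:A\to\mathbb{R}$ be the function defined in the context. Suppose that either one of the following two conditions holds: (a) There exist distinct points $x_0,x_1,\dots,x_k\in I$ such that, for all $0\le i\ne j\le k$ with $j\ne 0$, $r_j(x_j)>r_j(x_i)$. (b) There exist distinct points $x_0,x_1,\dots,x_k\in I$ such that, for every permutation $\pi$ of $\{0,1,\dots,k\}$ other than the identity, $$\sum_{j=0}^k r_j(x_j)\ne\sum_{j=0}^k r_j(x_{\pi(j)}).$$ Then $f_D(X_1)$ cannot be equal to zero with probability one for distortion levels $D>0$ arbitrarily close to zero; that is, there exists $\delta>0$ such that for no $D\in(0,D_{\max})$ with $D<\delta$ is $f_D(X_1)=0$ with probability one.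
   Context: $\log$ is to base 2 and $\log_e$ is the natural logarithm. For a probability mass function $Q$ on $\hat A$ and $D\ge 0$ let $$R(P,Q,D)=\inf_{(X,Z)}\big[I(X;Z)+H(Q_Z\|Q)\big],$$ where the infimum is over jointly distributed $(X,Z)$ with values in $A\times\hat A$ such that $X$ has distribution $P$ and $E[\rho(X,Z)]\le D$; $Q_Z$ is the distribution of $Z$, $I(X;Z)$ is mutual information in bits, and $H(R\|Q)=\sum_{a}R(a)\log[R(a)/Q(a)]$ is relative entropy in bits. The rate-distortion function is $R(D)=\inf_{(X,Y)} I(X;Y)$, the infimum being over jointly distributed $(X,Y)$ in $A\times\hat A$ with $X\sim P$ and $E[\rho(X,Y)]\le D$; thus $R(D)=\inf_Q R(P,Q,D)$, the infimum being over all probability mass functions $Q$ on $\hat A$. For $\lambda\le 0$ let $\Lambda_{P,Q}(\lambda)=E_P\big[\log_e E_Q\big(e^{\lambda\rho(X,Y)}\big)\big]$, where $X\sim P$ and $Y\sim Q$ are independent and the inner expectation is over $Y$ only; let $\Lambda^*_{P,Q}(D)=\sup_{\lambda\le 0}[\lambda D-\Lambda_{P,Q}(\lambda)]$. Known facts used to define $f$: for every $D\in(0,D_{\max})$ there is a $Q^*$ with $R(P,Q^*,D)=R(D)$, and for such a $Q^*$ there is a unique $\lambda^*<0$ with $\Lambda'_{P,Q^*}(\lambda^* )=D$; it satisfies $\lambda^*D-\Lambda_{P,Q^*}(\lambda^* )=\Lambda^*_{P,Q^*}(D)=(\log_e 2)R(P,Q^*,D)=(\log_e 2)R(D)$. For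 each $D\in(0,D_{\max})$ choose such $Q^*$ and $\lambda^*$ (depending on $D$) and define, for $x\in A$, $$f(x)=f_D(x)=(\log e)\Big[\lambda^*D-\log_e E_{Q^*}\big(e^{\lambda^*\rho(x,Y)}\big)\Big]-R(D),\qquad Y\sim Q^*.$$ *)

(* Defs.v *)
From HB Require Import structures.
From mathcomp Require Import all_boot all_order all_algebra all_fingroup.
From mathcomp Require Import all_classical all_reals all_analysis.

Set Implicit Arguments.
Unset Strict Implicit.
Unset Printing Implicit Defensive.

Import Order.TTheory GRing.Theory Num.Theory.
Import numFieldNormedType.Exports.

Local Open Scope classical_set_scope.
Local Open Scope ring_scope.

Definition log2 (R : realType) (x : R) : R := ln x / ln 2.

Section information.
Local Open Scope ereal_scope.
Local Open Scope charge_scope.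

(* The Radon-Nikodym derivative is finite-valued when mu `<< nu, so that [fine]
   loses nothing; the set where it is <= 0 is mu-negligible. *)
Definition relative_entropy d (T : measurableType d) (R : realType)
    (mu nu : probability T R) : \bar R :=
  if `[< mu `<< nu >] then
    \int[mu]_x (log2 (fine (('d (charge_of_finite_measure mu) '/d nu) x)))%:E
  else +oo.

Section joint_law.
Context d d1 d2 (T : measurableType d) (T1 : measurableType d1)
  (T2 : measurableType d2).

Definition pairRV (X : {mfun T >-> T1}) (Z : {mfun T >-> T2}) (w : T) :
  T1 * T2 := (X w, Z w).

Let measurable_pairRV X Z : measurable_fun setT (pairRV X Z).
Proof. by apply: measurable_fun_pair; exact: measurable_funPT. Qed.

HB.instance Definition _ X Z :=
  isMeasurableFun.Build _ _ _ _ (pairRV X Z) (@measurable_pairRV X Z).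

End joint_law.

Definition mutual_information d d1 d2 (T : measurableType d)
    (T1 : measurableType d1) (T2 : measurableType d2) (R : realType)
    (Pr : probability T R) (X : {RV Pr >-> T1}) (Z : {RV Pr >-> T2}) : \bar R :=
  relative_entropy (distribution Pr (pairRV X Z))
                   (distribution Pr X \x distribution Pr Z).

(* A probability mass function on {a_0, ..., a_(k-1)} is given by its values
   Q j = Q(a_j). *)
Definition is_pmf (R : realType) (k : nat) (Q : 'I_k -> R) : Prop :=
  (forall j, (0 <= Q j)%R) /\ (\sum_(j < k) Q j = 1)%R.

(* Conventions: 0 log (0 / q) = 0 for q >= 0, and p log (p / 0) = +oo for
   p > 0. *)
Definition pmf_relative_entropy (R : realType) (k : nat) (W Q : 'I_k -> R) :
    \bar R :=
  \sum_(j < k) if W j == 0%R then 0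
               else if Q j == 0%R then +oo
               else (W j * log2 (W j / Q j))%R%:E.

End information.

Section rate_distortion.
Context (R : realType) (k : nat) (a : 'I_k -> R) (rho : R -> R -> R).

(* Equality of the two laws is only required on measurable sets: measures of
   the library are unconstrained outside of them. *)
Definition has_law d (T : measurableType d) (Pr : probability T R)
    (X : {RV Pr >-> R}) (P : probability (measurableTypeR R) R) : Prop :=
  forall B : set R, measurable B -> distribution Pr X B = P B.

Definition admissible (P : probability (measurableTypeR R) R) (D : R)
    d (T : measurableType d) (Pr : probability T R)
    (X Z : {RV Pr >-> R}) : Prop :=
  [/\ has_law X P,
      forall w, exists j, Z w = a j
    & ('E_Pr[fun w => rho (X w) (Z w)] <= D%:E)%E].

Definition rate_PQ (P : probability (measurableTypeR R) R) (Q : 'I_k -> R)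
    (D : R) : \bar R :=
  ereal_inf [set v | exists d (T : measurableType d) (Pr : probability T R)
      (X Z : {RV Pr >-> R}),
    admissible P D X Z /\
    v = (mutual_information X Z +
         pmf_relative_entropy (fun j => pmf Z (a j)) Q)%E].

Definition rate_distortion (P : probability (measurableTypeR R) R) (D : R) :
    \bar R :=
  ereal_inf [set v | exists d (T : measurableType d) (Pr : probability T R)
      (X Y : {RV Pr >-> R}),
    admissible P D X Y /\ v = mutual_information X Y].

Definition Dmax (P : probability (measurableTypeR R) R) : \bar R :=
  (\big[mine/+oo]_(j < k) 'E_P[fun x => rho x (a j)])%E.

(* E_Q[exp(lambda * rho(x, Y))] with Y ~ Q. *)
Definition mgf_rho (Q : 'I_k -> R) (lambda x : R) : R :=
  \sum_(j < k) Q j * expR (lambda * rho x (a j)).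

Definition Lambda (P : probability (measurableTypeR R) R) (Q : 'I_k -> R)
    (lambda : R) : R :=
  \int[P]_x ln (mgf_rho Q lambda x).

(* Qs and ls choose, for every distortion level D in (0, Dmax), a minimizing
   pmf Q* and the corresponding multiplier lambda*; their values at other D are
   irrelevant. *)
Definition optimal_choice (P : probability (measurableTypeR R) R)
    (Qs : R -> 'I_k -> R) (ls : R -> R) : Prop :=
  forall D : R, 0 < D -> (D%:E < Dmax P)%E ->
    [/\ is_pmf (Qs D),
        rate_PQ P (Qs D) D = rate_distortion P D,
        ls D < 0
      & is_derive (ls D) 1 (Lambda P (Qs D)) D].

(* [fine] loses nothing: if sup_x min_y rho(x, y) = 0 and D > 0, then
   0 <= R(D) <= log2 k. *)
Definition f_D (P : probability (measurableTypeR R) R) (Qs : R -> 'I_k -> R)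
    (ls : R -> R) (D x : R) : R :=
  log2 (expR 1) * (ls D * D - ln (mgf_rho (Qs D) (ls D) x))
  - fine (rate_distortion P D).

(* r_0 = 0 and r_j = rho(., a_j): the index 0 is ord0, and the 0-based label
   j' of a point of the reproduction alphabet corresponds to lift ord0 j'. *)
Definition r_fun (j : 'I_k.+1) (x : R) : R :=
  if unlift ord0 j is Some j' then rho x (a j') else 0.

End rate_distortion.

(* On I, P is the sum of g dx and of some other measure. *)
Definition has_ac_component (R : realType)
    (P : probability (measurableTypeR R) R) (I : set R) (g : R -> R) : Prop :=
  measurable_fun I g /\
  exists nu : {measure set (measurableTypeR R) -> \bar R},
    forall B : set R, measurable B -> B `<=` I ->
      (P B = \int[lebesgue_measure]_(x in B) (g x)%:E + nu B)%E.

(* Main.v *)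
Require Import Defs.
From HB Require Import structures.
From mathcomp Require Import all_boot all_order all_algebra all_fingroup.
From mathcomp Require Import all_classical all_reals all_analysis.
From mathcomp Require Import measurable_realfun ring lra.

(* If [f_D(X_1) = 0] almost surely then, P having a positive density on I and
   f_D being continuous there, [E_(Q* )[exp(lambda* rho(x, Y))]] is a constant
   [c > 0] on I. Evaluating at [x_0, ..., x_k] makes (-c, Q* ) a nonzero left
   kernel vector of the matrix [exp(lambda* r_j(x_i))]. Its determinant is an
   exponential sum in lambda*, in which the exponent of the identity permutation
   is attained only once under (b), and (a) implies (b); hence it does not
   vanish for lambda* below some [- L]. Finally [D = Lambda'(lambda* )] is at least
   [exp(- L M) Dmax] when [lambda* >= - L], so a small D forces
   [lambda* < - L]. *)

Set Implicit Arguments.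
Unset Strict Implicit.
Unset Printing Implicit Defensive.

Import Order.TTheory GRing.Theory Num.Theory.
Import numFieldNormedType.Exports.

Local Open Scope classical_set_scope.
Local Open Scope ring_scope.

(** * Exponential sums and the determinant of the matrix of exponentials *)

Lemma expR_scaled_cvg0 (R : realType) (e : R) : 0 < e ->
  expR (- (mu * e)) @[mu --> +oo] --> 0.
Proof.
move=> e0.
apply: (@cvg_comp _ _ _ (fun mu => mu * e) (fun y => expR (- y)) _ +oo).
  by apply: gt0_cvgMly => //; exact: cvg_id.
exact: cvgr_expR.
Qed.

(* Induction on [A]: the terms of least exponent either dominate the sum or
   cancel out; in the latter case [s0] is not among them. *)
Lemma near_exp_sum_neq0 (R : realType) (S : finType) (c t : S -> R) (s0 : S)
    (A : {set S}) :
  s0 \in A -> c s0 != 0 -> (forall s, s != s0 -> t s != t s0) ->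
  \forall mu \near +oo, \sum_(s in A) c s * expR (- mu * t s) != 0.
Proof.
move=> + cs0 ts0; have [n] := ubnP #|A|; elim: n A => // n IHn A /ltnSE An s0A.
case: (@arg_minP _ _ _ s0 (mem A) t s0A) => s1 /= s1A s1_min.
have {}s1A : s1 \in A by [].
pose B := [set s in A | t s == t s1].
have BA : B \subset A by apply/fintype.subsetP => s; rewrite inE => /andP[].
have split_sum mu : \sum_(s in A) c s * expR (- mu * t s) =
    (\sum_(s in B) c s) * expR (- mu * t s1) +
    \sum_(s in A :\: B) c s * expR (- mu * t s).
  rewrite (big_setID B) /= (finset.setIidPr BA) mulr_suml; congr (_ + _).
  by apply: eq_bigr => s; rewrite inE => /andP[_ /eqP ->].
have [C0|C0] := eqVneq (\sum_(s in B) c s) 0.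
  have s0B : s0 \notin B.
    (* If [s0] had the least exponent, [B] would be [{s0}], whose coefficient sum [c s0] is
       nonzero. *)
    apply/negP; rewrite inE => /andP[_ /eqP t01].
    move: C0; rewrite (_ : B = [set s0]%SET) ?big_set1; first exact/eqP.
    apply/setP => s; rewrite !inE -t01.
    have [->|/ts0/negPf ->] := eqVneq s s0; last by rewrite andbF.
    by rewrite s0A eqxx.
  have : s0 \in A :\: B by rewrite inE s0B.
  have s1B : s1 \in B by rewrite inE s1A eqxx.
  have ltAB : (#|A :\: B| < n)%N.
    apply: leq_trans An; apply: proper_card; apply/properP; split.
      exact: subsetDl.
    by exists s1 => //; rewrite inE s1B.
  move=> /(IHn _ ltAB); apply: filterS => mu.
  by rewrite split_sum C0 mul0r add0r.
(* After division by [expR (- mu * t s1)] the terms outside [B] tend to 0, so the limit is the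
   nonzero coefficient sum over [B]. *)
have : (\sum_(s in B) c s) +
    \sum_(s in A :\: B) c s * expR (- (mu * (t s - t s1)))
    @[mu --> +oo] --> (\sum_(s in B) c s) + \sum_(s in A :\: B) c s * 0.
  apply: cvgD; first exact: cvg_cst.
  apply: cvg_big => [|s]; first exact: add_continuous.
  rewrite !inE => /andP[+ sA]; rewrite sA /= => tss1.
  apply: cvgMr; apply: expR_scaled_cvg0.
  by rewrite subr_gt0 lt_neqAle eq_sym tss1 s1_min.
rewrite [X in _ + X]big1 ?addr0; last by move=> s _; rewrite mulr0.
move=> /cvgr_neq0 -/(_ C0); apply: filterS => mu.
apply: contra_neq; rewrite split_sum => sum0.
apply: (mulIf (lt0r_neq0 (expR_gt0 (- mu * t s1)))).
rewrite mul0r -[RHS]sum0 mulrDl; congr (_ + _).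
rewrite mulr_suml; apply: eq_bigr => s _.
by rewrite -mulrA -expRD; congr (_ * expR _); ring.
Qed.

(** Indexing rows by functions and columns by points makes the exponents of the Leibniz formula the
    sums compared in condition (b). *)
Lemma det_expE (R : realType) (n : nat) (r : 'I_n -> R -> R) (x : 'I_n -> R)
    (lambda : R) :
  \det (\matrix_(j, i) expR (lambda * r j (x i))) =
  \sum_(s : 'S_n) (-1) ^+ s * expR (lambda * \sum_j r j (x (s j))).
Proof.
rewrite /determinant; apply: eq_bigr => s _; congr (_ * _).
rewrite mulr_sumr expR_sum; apply: eq_bigr => j _.
by rewrite mxE.
Qed.

(** By injectivity, a permutation that fixes every nonzero index also fixes 0. A nonzero moved index
    is what condition (a) can be applied to. *)
Lemma perm_neq1_moves (n : nat) (s : 'S_n.+1) : s <> 1%g ->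
  exists2 j, j != ord0 & s j != j.
Proof.
move=> s1; apply: contrapT => nex; apply: s1; apply/permP.
have fixj j : j != ord0 -> s j = j.
  move=> j0; apply/eqP; apply: contrapT => /negP sj; apply: nex.
  by exists j.
move=> j; rewrite perm1; have [->|] := eqVneq j ord0; last exact: fixj.
apply: contrapT => s0; case: (s0); apply: (@perm_inj _ s).
by apply: fixj; exact/eqP.
Qed.

(** This is the passage from (a) to (b): no term increases, since [r ord0] is constant and every
    other [r j] is largest at [x j] among the points; a moved nonzero index gives a strict drop. *)
Lemma sum_perm_lt (R : realType) (n : nat) (r : 'I_n.+1 -> R -> R)
    (x : 'I_n.+1 -> R) (s : 'S_n.+1) :
  (forall y z, r ord0 y = r ord0 z) ->
  (forall i j, i != j -> j != ord0 -> r j (x i) < r j (x j)) ->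
  s <> 1%g -> \sum_j r j (x (s j)) < \sum_j r j (x j).
Proof.
move=> r0 rx /perm_neq1_moves[j j0 sj].
rewrite (bigD1 j) //= [ltRHS](bigD1 j) //=.
apply: ltr_leD; first exact: rx.
apply: ler_sum => i _; have [->|si] := eqVneq (s i) i; first by [].
by have [->|/(rx _ _ si)/ltW //] := eqVneq i ord0; rewrite (r0 _ (x ord0)).
Qed.

(** * From almost sure vanishing to vanishing everywhere on [I] *)

(** If [P B = 0], the integral of [g] over [B] is 0, so [B] is Lebesgue-null because [g > 0] there;
    yet [B] contains a ball. *)
Lemma has_ac_component_gt0 (R : realType)
    (P : probability (measurableTypeR R) R) (I : set R) (g : R -> R)
    (B : set R) :
  measurable I -> has_ac_component P I g -> (forall x, I x -> 0 < g x) ->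
  open B -> B `<=` I -> B !=set0 -> (0 < P B)%E.
Proof.
move=> mI [mg [nu Pnu]] g0 oB BI [x0 Bx0].
have mB : measurable B by exact: open_measurable.
rewrite lt0e measure_ge0 andbT; apply/eqP => PB0.
have int_ge0 : (0 <= \int[lebesgue_measure]_(x in B) (g x)%:E)%E.
  by apply: integral_ge0 => x Bx; rewrite lee_fin ltW // g0 //; exact: BI.
have int0 : (\int[lebesgue_measure]_(x in B) (g x)%:E = 0)%E.
  have := Pnu B mB BI; rewrite PB0 => /esym/eqP.
  by rewrite padde_eq0 ?measure_ge0 // => /andP[/eqP].
have mgB : measurable_fun B (EFin \o g).
  by apply/measurable_EFinP; exact: (measurable_funS mI BI mg).
have absint0 : (\int[lebesgue_measure]_(x in B) `|(g x)%:E| = 0)%E.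
  rewrite -int0; apply: eq_integral => x; rewrite inE => /BI /g0 gx.
  by rewrite gee0_abs // lee_fin ltW.
move/(ae_eq_integral_abs lebesgue_measure mB mgB) : absint0.
move=> [N [mN N0 BN]].

have BsubN : B `<=` N.
  move=> x Bx; apply: BN => /(_ Bx) [] gx0.
  by have := g0 _ (BI _ Bx); rewrite gx0 ltxx.
have /nbhs_ballP[e /= e0 eB] : nbhs x0 B by exact: open_nbhs_nbhs.
have : (lebesgue_measure (ball x0 e) <= lebesgue_measure N)%E.
  apply: le_measure; rewrite ?inE //; first exact: measurable_ball.
  exact: subset_trans eB BsubN.
by rewrite N0 lebesgue_measure_ball ?(ltW e0) // lee_fin leNgt mulrn_wgt0.
Qed.

(** By continuity the points of [I] where [f] is nonzero form an open set, which would have positive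
    [P]-measure if it were nonempty. *)
Lemma ae_eq0_in_ac_component (R : realType)
    (P : probability (measurableTypeR R) R) (I : set R) (g : R -> R)
    d (T : measurableType d) (Pr : probability T R) (X : {RV Pr >-> R})
    (f : R -> R) :
  has_ac_component P I g -> (forall x, I x -> 0 < g x) -> open I ->
  has_law X P -> (forall x, I x -> {for x, continuous f}) ->
  {ae Pr, forall w, f (X w) = 0} -> forall x, I x -> f x = 0.
Proof.
move=> Pac g0 oI XP cf [N [mN N0 fN]] x Ix.
apply: contrapT => fx; pose B := I `&` [set y | f y != 0].
have oB : open B.
  rewrite openE => y [Iy fy]; apply: filterI; first exact: open_nbhs_nbhs.
  exact: cvgr_neq0 (cf _ Iy) fy.
have : (0 < P B)%E.
  apply: (has_ac_component_gt0 (open_measurable oI) Pac g0 oB).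
    by move=> y [].
  by exists x; split => //; apply/eqP.
have mB : measurable B by exact: open_measurable.
rewrite -XP // /distribution /pushforward ltNge => /negP; apply.
rewrite -N0; apply: le_measure; rewrite ?inE //.
  by rewrite -[_ @^-1` _]setTI; exact: measurable_funPT.
by move=> w [_ /eqP fw]; exact: fN.
Qed.

(** * A lower bound on the derivative of [Lambda] *)

(** The derivative is already the limit of the right difference quotients, and the increments of
    [Lambda] are estimated only for [h >= 0]. *)
Lemma is_derive_lower_bound (R : realType) (f : R -> R) (x l c : R) :
  is_derive x 1 f l ->
  (\forall h \near 0^'+, c * h <= f (x + h) - f x) -> c <= l.
Proof.
move=> [df <-] fc.
have quot : h^-1 *: ((f \o shift x) (h *: 1) - f x) @[h --> 0^'+] -->
    'D_1 f x.
  by apply: cvg_dnbhs_at_right; exact: df.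
rewrite -(cvg_lim (@Rhausdorff R) quot); apply: limr_ge.
  by apply/cvg_ex; exists ('D_1 f x).
near=> h.
have h0 : 0 < h by [].
rewrite /= /shift /= [_ *: 1]mulr1 [h + x]addrC.
rewrite -[X in _ <= X]/(_ * _) ler_pdivlMl // mulrC.
by near: h.
Unshelve. all: by end_near. Qed.

Lemma bounded_integrable (R : realType) d (T : measurableType d)
    (P : probability T R) (f : T -> R) (C : R) :
  measurable_fun setT f -> (forall x, `|f x| <= C) ->
  P.-integrable setT (EFin \o f).
Proof.
move=> mf fC; apply: measurable_bounded_integrable => //.
  exact: fin_num_fun_lty.
by exists C; split => [|B CB x _]; [exact: num_real|exact: le_trans (ltW CB)].
Qed.

Section mgf.
Context (R : realType) (k : nat) (a : 'I_k -> R) (M : R) (rho : R -> R -> R)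
  (P : probability (measurableTypeR R) R) (Q : 'I_k -> R).
Hypothesis rho_bounded : forall x j, 0 <= rho x (a j) <= M.
Hypothesis rho_measurable :
  forall j, measurable_fun setT (fun x => rho x (a j)).
Hypothesis Qpmf : is_pmf Q.

Lemma mgf_rho_bounds (lambda x : R) : lambda <= 0 ->
  expR (lambda * M) <= mgf_rho a rho Q lambda x <= 1.
Proof.
move=> l0; have [Q0 Q1] := Qpmf; rewrite /mgf_rho; apply/andP; split.
  rewrite -[leLHS]mul1r -Q1 mulr_suml; apply: ler_sum => j _.
  apply: ler_wpM2l; first exact: Q0.
  by rewrite ler_expR ler_wnM2l //; have /andP[] := rho_bounded x j.
rewrite -Q1; apply: ler_sum => j _.
rewrite -[leRHS]mulr1; apply: ler_wpM2l; first exact: Q0.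
rewrite -expR0 ler_expR mulr_le0_ge0 //; by have /andP[] := rho_bounded x j.
Qed.

Lemma measurable_mgf_rho (lambda : R) :
  measurable_fun setT (mgf_rho a rho Q lambda).
Proof.
apply: measurable_sum => j; apply: measurable_funM => //.
by apply: measurableT_comp => //; apply: measurable_funM.
Qed.

Lemma ln_mgf_rho_integrable (lambda : R) : lambda <= 0 ->
  P.-integrable setT (EFin \o (fun x => ln (mgf_rho a rho Q lambda x))).
Proof.
move=> l0; apply: (@bounded_integrable _ _ _ _ _ (- (lambda * M))).
  by apply: measurableT_comp => //; exact: measurable_mgf_rho.
move=> x; have /andP[lb ub] := mgf_rho_bounds x l0.
have mgf0 : 0 < mgf_rho a rho Q lambda x := lt_le_trans (expR_gt0 _) lb.
rewrite ler0_norm ?lerN2; last exact: ln_le0.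
by rewrite -(expRK (lambda * M)) ler_ln // posrE expR_gt0.
Qed.

(* [ln u - ln v >= u - v] for [0 < v <= u <= 1], and
   [exp (h r) - 1 >= h r]. *)
Lemma ln_mgf_rho_incr (L lambda h x : R) : - L <= lambda -> 0 <= h ->
    lambda + h <= 0 ->
  expR (- L * M) * h * \sum_(j < k) Q j * rho x (a j) <=
  ln (mgf_rho a rho Q (lambda + h) x) - ln (mgf_rho a rho Q lambda x).
Proof.
move=> Ll h0 lh0; have [Q0 Q1] := Qpmf.
have l0 : lambda <= 0 by apply: le_trans lh0; rewrite lerDl.
have /andP[vlb vub] := mgf_rho_bounds x l0.
have /andP[ulb uub] := mgf_rho_bounds x lh0.
have diff : expR (- L * M) * h * \sum_(j < k) Q j * rho x (a j) <=
    mgf_rho a rho Q (lambda + h) x - mgf_rho a rho Q lambda x.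
  rewrite /mgf_rho -sumrB mulr_sumr; apply: ler_sum => j _.
  have /andP[r0 rM] := rho_bounded x j.
  rewrite -mulrBr mulrCA; apply: ler_wpM2l; first exact: Q0.
  rewrite mulrDl expRD -{2}[expR (lambda * _)]mulr1 -mulrBr -mulrA.
  apply: ler_pM; rewrite ?expR_ge0 ?mulr_ge0 //.
    (* The chain is [- L * M <= - L * rho x (a j) <= lambda * rho x (a j)]; its first half uses
       [- L <= lambda <= 0]. *)
    rewrite ler_expR; apply: (@le_trans _ _ (- L * rho x (a j))).
      apply: ler_wnM2l => //; exact: le_trans l0.
    exact: ler_wpM2r.
  by rewrite lerBrDl expR_ge1Dx.
apply: (le_trans diff).
have v0 : 0 < mgf_rho a rho Q lambda x := lt_le_trans (expR_gt0 _) vlb.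
have u0 : 0 < mgf_rho a rho Q (lambda + h) x := lt_le_trans (expR_gt0 _) ulb.
set v := mgf_rho _ _ _ lambda _ in diff vlb vub v0 *.
set u := mgf_rho _ _ _ (lambda + h) _ in diff ulb uub u0 *.
have uv0 : 0 <= u - v.
  apply: le_trans diff; rewrite !mulr_ge0 ?expR_ge0 // sumr_ge0 // => j _.
  by rewrite mulr_ge0 //; have /andP[] := rho_bounded x j.
(* Since [expR (ln v - ln u) = v / u], this gives [ln u - ln v >= (u - v) / u], which is at least
   [u - v] as [u <= 1]. *)
have := expR_ge1Dx (ln v - ln u).
rewrite expRB !lnK ?posrE // => lnuv.
apply: (@le_trans _ _ ((u - v) / u)).
  by rewrite ler_pdivlMr // ler_piMr.
rewrite mulrBl divff ?gt_eqF //; lra.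
Qed.

(** The pointwise increment bound is integrated over [P]; as [Q] sums to 1, the mean distortion
    under [P] and [Q] is at least [m]. *)
Lemma derive_Lambda_lower_bound (L m lambda D : R) :
    (forall j, m <= \int[P]_x rho x (a j)) ->
    - L <= lambda -> lambda < 0 ->
  is_derive lambda 1 (Lambda a rho P Q) D -> expR (- L * M) * m <= D.
Proof.
move=> mr Ll l0 /is_derive_lower_bound; apply; have [Q0 Q1] := Qpmf.
have rint j : P.-integrable setT (EFin \o (fun x => rho x (a j))).
  apply: (@bounded_integrable _ _ _ _ _ M); first exact: rho_measurable.
  move=> x; by have /andP[? ?] := rho_bounded x j; rewrite ger0_norm.
have Qrint j : P.-integrable setT (EFin \o (fun x => Q j * rho x (a j))).
  exact: (integrableZl measurableT (Q j) (rint j)).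
have sumint : P.-integrable setT
    (EFin \o (fun x => \sum_(j < k) Q j * rho x (a j))).
  rewrite (_ : _ \o _ = (fun x => \sum_(j < k) (Q j * rho x (a j))%:E)%E).
    exact: (integrable_sum measurableT _ (fun j _ => Qrint j)).
  by apply/funext => x /=; rewrite -sumEFin.
have mean : m <= \int[P]_x (\sum_(j < k) Q j * rho x (a j)).
  rewrite /Rintegral; under eq_integral do rewrite -sumEFin.
  rewrite integral_sum // -sum_fine => [|j _]; last first.
    exact: integrable_fin_num (Qrint j).
  rewrite -[m]mul1r -Q1 mulr_suml; apply: ler_sum => j _.
  rewrite -[leRHS]/(\int[P]_x (Q j * rho x (a j))) RintegralZl //.
  exact: ler_wpM2l.
near=> h.
have h0 : 0 <= h by apply: ltW; near: h; exact: nbhs_right_gt.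
(* As [lambda < 0], a small step to the right stays in the range where the bounds on [mgf_rho]
   hold. *)
have lh0 : lambda + h <= 0.
  rewrite -lerBrDl sub0r; near: h; apply: nbhs_right_le.
  by rewrite oppr_gt0.
rewrite /Lambda -RintegralB //; first last.
- exact: ln_mgf_rho_integrable (ltW l0).
- exact: ln_mgf_rho_integrable.
apply: (@le_trans _ _ (expR (- L * M) * h *
    \int[P]_x (\sum_(j < k) Q j * rho x (a j)))).
  by rewrite mulrAC ler_wpM2l // mulr_ge0 // expR_ge0.
rewrite -RintegralZl //; apply: le_Rintegral => //.
- exact: (integrableZl measurableT _ sumint).
- exact: (integrableB measurableT (ln_mgf_rho_integrable lh0)
    (ln_mgf_rho_integrable (ltW l0))).
- by move=> x _; exact: ln_mgf_rho_incr.
Unshelve. all: by end_near. Qed.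

End mgf.

(** * The kernel vector, continuity of [f_D], and finiteness of [Dmax] *)

Lemma r_fun_lift (R : realType) (k : nat) (a : 'I_k -> R) (rho : R -> R -> R)
    (j : 'I_k) : r_fun a rho (lift ord0 j) = fun x => rho x (a j).
Proof. by apply/funext => x; rewrite /r_fun liftK. Qed.

Lemma r_fun0 (R : realType) (k : nat) (a : 'I_k -> R) (rho : R -> R -> R)
    (x : R) : r_fun a rho ord0 x = 0.
Proof. by rewrite /r_fun unlift_none. Qed.

(** Row 0 of the matrix is all ones because [r_0 = 0], so [(- c, Q)] times column [i] is
    [mgf_rho a rho Q lambda (x i) - c]. *)
Lemma det_eq0_of_mgf_rho_cst (R : realType) (k : nat) (a : 'I_k -> R)
    (rho : R -> R -> R) (Q : 'I_k -> R) (lambda c : R) (x : 'I_k.+1 -> R) :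
  c != 0 -> (forall i, mgf_rho a rho Q lambda (x i) = c) ->
  \det (\matrix_(j, i) expR (lambda * r_fun a rho j (x i))) = 0.
Proof.
move=> c0 mgfc; apply/eqP/det0P.
exists (\row_j if unlift ord0 j is Some j' then Q j' else - c).
  apply/eqP => /matrixP /(_ ord0 ord0) /eqP.
  by rewrite !mxE unlift_none oppr_eq0 (negPf c0).
apply/rowP => i; rewrite !mxE big_ord_recl !mxE unlift_none r_fun0 mulr0 expR0.
rewrite mulr1 -(mgfc i) /mgf_rho; apply/eqP; rewrite addrC subr_eq0; apply/eqP.
by apply: eq_bigr => j _; rewrite !mxE liftK r_fun_lift.
Qed.

Lemma f_D_continuous (R : realType) (k : nat) (a : 'I_k -> R)
    (rho : R -> R -> R) (P : probability (measurableTypeR R) R)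
    (Qs : R -> 'I_k -> R) (ls : R -> R) (D x : R) :
  0 < mgf_rho a rho (Qs D) (ls D) x ->
  (forall j, {for x, continuous (fun y => rho y (a j))}) ->
  {for x, continuous (f_D a rho P Qs ls D)}.
Proof.
move=> mgf0 crho.
have cmgf : {for x, continuous (mgf_rho a rho (Qs D) (ls D))}.
  apply: cvg_big => [|j _]; first exact: add_continuous.
  apply: cvgM; first exact: cvg_cst.
  apply: (continuous_comp (f := fun y => ls D * rho y (a j))).
    by apply: cvgM; [exact: cvg_cst|exact: crho].
  exact: continuous_expR.
apply: cvgB; last exact: cvg_cst.
apply: cvgM; first exact: cvg_cst.
apply: cvgB; first exact: cvg_cst.
exact: continuous_comp cmgf (continuous_ln mgf0).
Qed.

(** The witness is [Dmax] itself, finite because a minimum over a nonempty alphabet is at most one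
    of the finite means. *)
Lemma Dmax_lower_bound (R : realType) (k : nat) (a : 'I_k -> R) (M : R)
    (rho : R -> R -> R) (P : probability (measurableTypeR R) R) :
  (0 < k)%N -> (forall x j, 0 <= rho x (a j) <= M) ->
  (forall j, measurable_fun setT (fun x => rho x (a j))) ->
  (0 < Dmax a rho P)%E ->
  exists2 m : R, 0 < m & forall j, m <= \int[P]_x rho x (a j).
Proof.
move=> k0 rho_bounded rho_measurable D0.
have meanE j : 'E_P[fun x => rho x (a j)]%E = (\int[P]_x rho x (a j))%:E.
  rewrite unlock /Rintegral fineK //; apply: integrable_fin_num => //.
  apply: (@bounded_integrable _ _ _ _ _ M); first exact: rho_measurable.
  by move=> x; have /andP[? ?] := rho_bounded x j; rewrite ger0_norm.
have Dle j : (Dmax a rho P <= (\int[P]_x rho x (a j))%:E)%E.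
  by rewrite -meanE /Dmax; exact: bigmin_le.
have Dfin : Dmax a rho P \is a fin_num.
  rewrite ge0_fin_numE; last exact: ltW.
  exact: le_lt_trans (Dle (Ordinal k0)) (ltry _).
exists (fine (Dmax a rho P)) => [|j].
  by rewrite -lte_fin fineK.
by rewrite -lee_fin fineK.
Qed.

(** * Choice of the threshold and the contradiction *)

Theorem theorem3 (R : realType) (k : nat) (k_gt0 : (0 < k)%N)
    (a : 'I_k -> R) (a_inj : injective a)
    (M : R) (rho : R -> R -> R)
    (rho_bounded : forall x j, 0 <= rho x (a j) <= M)
    (rho_measurable : forall j, measurable_fun setT (fun x => rho x (a j)))
    (rho_sup_min :
      ereal_sup [set (\big[mine/+oo]_(j < k) (rho x (a j))%:E)%E | x in setT]
      = 0%E)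
    (P : probability (measurableTypeR R) R)
    (Dmax_gt0 : (0 < Dmax a rho P)%E)
    (I : set R) (I_interval : is_interval I) (I_open : open I)
    (I_neq0 : I !=set0)
    (g : R -> R) (P_ac : has_ac_component P I g)
    (g_gt0 : forall x, I x -> 0 < g x)
    (r_continuous : forall j : 'I_k.+1, {within I, continuous (r_fun a rho j)})
    (Qs : R -> 'I_k -> R) (ls : R -> R)
    (optimal : optimal_choice a rho P Qs ls)
    (d : measure_display) (T : measurableType d) (Pr : probability T R)
    (X1 : {RV Pr >-> R}) (X1_law : has_law X1 P)
    (condition :
      (exists x : 'I_k.+1 -> R,
        [/\ injective x, forall i, I (x i)
          & forall i j : 'I_k.+1, i != j -> j != ord0 ->
              r_fun a rho j (x i) < r_fun a rho j (x j)])
      \/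
      (exists x : 'I_k.+1 -> R,
        [/\ injective x, forall i, I (x i)
          & forall s : {perm 'I_k.+1}, s <> 1%g ->
              \sum_j r_fun a rho j (x j) <> \sum_j r_fun a rho j (x (s j))])) :
  exists2 delta : R, 0 < delta &
    forall D : R, 0 < D -> (D%:E < Dmax a rho P)%E -> D < delta ->
      ~ {ae Pr, forall w, f_D a rho P Qs ls D (X1 w) = 0}.
Proof.
(* Both conditions are brought to the form (b). *)
have [x [xI x_sums]] : exists x : 'I_k.+1 -> R, (forall i, I (x i)) /\
    forall s : {perm 'I_k.+1}, s != 1%g ->
      \sum_j r_fun a rho j (x (s j)) != \sum_j r_fun a rho j (x j).
  case: condition => -[x [_ xI rx]]; exists x; split=> // s /eqP s1.
    by rewrite lt_eqF // sum_perm_lt // => y z; rewrite !r_fun0.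
  by apply/eqP => /esym; exact: rx.
have [m m0 mle] := Dmax_lower_bound k_gt0 rho_bounded rho_measurable Dmax_gt0.
pose t (s : {perm 'I_k.+1}) := \sum_j r_fun a rho j (x (s j)).
(* Here [mu] stands for [- lambda]; [L] is such that the determinant is nonzero for every
   [mu > L]. *)
have [||L [_ L_det]] := @near_exp_sum_neq0 R {perm 'I_k.+1}
    (fun s => (-1) ^+ s) t 1%g
    [set: {perm 'I_k.+1}]%SET (finset.in_setT _).
- by rewrite signr_eq0.
- move=> s s1; rewrite [X in _ != X](_ : _ = \sum_j r_fun a rho j (x j)).
    exact: x_sums.
  by apply: eq_bigr => j _; rewrite perm1.
(* This bounds [D] from below whenever [- L <= ls D], so a smaller [D] has [ls D < - L]. *)
exists (expR (- L * M) * m); first by rewrite mulr_gt0 ?expR_gt0.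
move=> D D0 DDmax Ddelta fD0.
have [Qpmf _ ls0 dLambda] := optimal D D0 DDmax.
have lsL : L < - ls D.
  rewrite ltrNr ltNge; apply/negP => Lls.
  have := derive_Lambda_lower_bound rho_bounded rho_measurable Qpmf mle Lls ls0
    dLambda.
  by rewrite leNgt Ddelta.
have mgf_gt0 y : 0 < mgf_rho a rho (Qs D) (ls D) y.
  have /andP[+ _] := mgf_rho_bounds rho_bounded Qpmf y (ltW ls0).
  exact/lt_le_trans/expR_gt0.
have crho y j : I y -> {for y, continuous (fun z => rho z (a j))}.
  move=> Iy; have := r_continuous (lift ord0 j).
  rewrite r_fun_lift continuous_open_subspace //; apply; exact/mem_set.
have fI : forall y, I y -> f_D a rho P Qs ls D y = 0.
  apply: (ae_eq0_in_ac_component P_ac g_gt0 I_open X1_law _ fD0) => y Iy.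
  by apply: f_D_continuous => // j; exact: crho.
(* Solving [f_D = 0] for [mgf_rho] gives a positive value independent of the point. *)
have mgf_cst i : mgf_rho a rho (Qs D) (ls D) (x i) =
    expR (ls D * D - fine (rate_distortion a rho P D) / log2 (expR 1)).
  have log2e : log2 (expR 1 : R) != 0.
    by rewrite /log2 expRK mul1r invr_eq0 gt_eqF // ln_gt0 // ltr1n.
  have /eqP := fI _ (xI i); rewrite /f_D subr_eq0 => /eqP <-.
  by rewrite mulrAC divff // mul1r subKr lnK ?posrE.
have := det_eq0_of_mgf_rho_cst (lt0r_neq0 (expR_gt0 _)) mgf_cst.
rewrite det_expE; apply/eqP; have := L_det _ lsL; rewrite opprK.
by under eq_bigl do rewrite finset.in_setT.
Qed.
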